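(* Let $(\Omega,\mathcal F,\Pr)$ be a probability space with filtration $\{\mathcal F_n\}_{n\ge0}$, and let $\{z_n\},\{a_n\},\{x_n\},\{y_n\}$ be non-negative real-valued sequences adapted to $\{\mathcal F_n\}$ satisfying $$\mathbb{E}[z_{n+1}\mid\mathcal F_n]\le(1+a_n)z_n+x_n-y_n\quad\text{a.s. for all }n\ge0.$$ Suppose: (A1) $\sum_n a_n<\infty$ a.s.; (A2) $|z_{n+1}-z_n|\le b_n(z_n+1)$ a.s. for all $n$, where $\{b_n\}$ is a non-negative real-valued sequence adapted to $\{\mathcal F_n\}$ with $\sum_n b_n^2<\infty$ a.s.; (A3) there is a constant $B\ge 0$ such that for all $n$, $z_n>B$ implies $x_n-y_n\le -c_n(z_n-B)$, where $\{c_n\}$ is a non-negative real-valued sequence adapted to $\{\mathcal F_n\}$ with $\sum_n c_n=\infty$ a.s. Then $\lim_{n\to\infty} d(z_n,[0,B])=0$ a.s.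
   Context: For $z\in\mathbb R$ and an interval $Z\subset\mathbb R$, $d(z,Z)\doteq\inf_{\tilde z\in Z}|z-\tilde z|$; in particular $d(z,[0,B])=\max(z-B,0)$ for $z\ge 0$. *)

(* Defs.v *)
From HB Require Import structures.
From mathcomp Require Import all_boot all_order all_algebra.
From mathcomp Require Import all_classical all_reals all_analysis.
From mathcomp Require Import measurable_realfun.
Set Implicit Arguments. Unset Strict Implicit. Unset Printing Implicit Defensive.
Import Order.TTheory GRing.Theory Num.Theory.
Import numFieldNormedType.Exports.
Local Open Scope classical_set_scope.
Local Open Scope ring_scope.

Definition sub_sigma_algebra d (T : measurableType d) (G : set (set T)) :=
  sigma_algebra setT G /\ G `<=` measurable.

Definition filtration d (T : measurableType d) (F : nat -> set (set T)) :=
  (forall n, sub_sigma_algebra (F n)) /\ (forall n, F n `<=` F n.+1).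

Definition G_measurable d (T : measurableType d) d' (U : measurableType d')
    (G : set (set T)) (f : T -> U) :=
  forall B : set U, measurable B -> G (f @^-1` B).

Definition adapted d (T : measurableType d) (R : realType)
    (F : nat -> set (set T)) (u : nat -> T -> R) :=
  forall n, G_measurable (F n) (u n).

(** h is (a version of) the conditional expectation E[X | G] of a
    non-negative random variable X: h is a non-negative extended-real
    G-measurable function with  int_A h dP = int_A X dP  for all A in G. *)
Definition is_cond_exp d (T : measurableType d) (R : realType)
    (P : probability T R) (G : set (set T)) (X : T -> R) (h : T -> \bar R) :=
  [/\ G_measurable G h, (forall w, (0 <= h w)%E) &
      forall A, G A -> (\int[P]_(w in A) h w = \int[P]_(w in A) (X w)%:E)%E].

(** d(z,[0,B]) for z >= 0, as in the paper's convention. *)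
Definition dist0B (R : realType) (B z : R) : R := Num.max (z - B) 0.

(* Main.v *)
Require Import Defs.
From HB Require Import structures.
From mathcomp Require Import all_boot all_order all_algebra.
From mathcomp Require Import all_classical all_reals all_analysis.
From mathcomp Require Import measurable_realfun ring lra.
Set Implicit Arguments. Unset Strict Implicit. Unset Printing Implicit Defensive.
Import Order.TTheory GRing.Theory Num.Theory.
Import numFieldNormedType.Exports.
Local Open Scope classical_set_scope.
Local Open Scope ring_scope.

(** With [s = (z - B)^+], convexity gives
    [s_{n+1}^2 <= s_n^2 + 2 s_n (z_{n+1} - z_n) + (z_{n+1} - z_n)^2], so that
    [E[s_{n+1}^2 + 1 | F_n] <= (1 + C (a_n + b_n^2)) (s_n^2 + 1) - 2 c_n s_n^2]
    with [C = 2 (B + 1)^2]. Discounting by [e_n = exp (- C sum_(k < n) (a_k + b_k^2))],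
    which stays away from [0], turns [e_n (s_n^2 + 1)] into a supermartingale
    whose decrements [2 c_n s_n^2 e_{n+1}] are almost surely summable; as the
    [c_n] are not, [W_n = e_n s_n^2] is frequently small. Finally, after a time
    at which [W <= delta], the maximal inequality bounds the probability that
    [W] comes back to [eps] by [(delta + E[e_N] - lim E[e_n]) / eps], so [W]
    converges to [0]. *)

(** * Measurability relative to a sub-sigma-algebra, via the type [g_sigma_algebraType G] *)

Section sub_sigma_algebra_measurability.
Context d (T : measurableType d) (G : set (set T)).
Hypothesis sG : Defs.sub_sigma_algebra G.
Let GT : measurableType G.-sigma := g_sigma_algebraType G.

Lemma g_sigma_measurableE (A : set T) : measurable (A : set GT) = G A.
Proof. by have := measurable_g_measurableTypeE sG.1; rewrite funeqE; apply. Qed.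

Lemma G_measurableP d' (U : measurableType d') (f : T -> U) :
  G_measurable G f <-> measurable_fun setT (f : GT -> U).
Proof.
split=> [Gf _ B mB|mf B mB]; first by rewrite setTI g_sigma_measurableE; exact: Gf.
by rewrite -g_sigma_measurableE -[X in measurable X]setTI; exact: mf.
Qed.

Lemma G_measurable_measurable d' (U : measurableType d') (f : T -> U) :
  G_measurable G f -> measurable_fun setT f.
Proof. by move=> Gf _ B mB; rewrite setTI; apply: sG.2; exact: Gf. Qed.

Lemma sub_sigma_measurable (A : set T) : G A -> measurable A.
Proof. exact: sG.2. Qed.

Lemma sub_sigmaT : G setT.
Proof. by rewrite -g_sigma_measurableE; exact: (@measurableT _ GT). Qed.

Lemma sub_sigmaI (A B : set T) : G A -> G B -> G (A `&` B).
Proof. by rewrite -!g_sigma_measurableE; exact: measurableI. Qed.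

Lemma sub_sigmaU (A B : set T) : G A -> G B -> G (A `|` B).
Proof. by rewrite -!g_sigma_measurableE; exact: measurableU. Qed.

End sub_sigma_algebra_measurability.

(** * Pulling a measurable factor out of a conditional expectation *)

Section conditional_expectation.
Context d (T : measurableType d) (R : realType) (P : probability T R).
Variables (G : set (set T)) (X : T -> R) (h : T -> \bar R).
Hypotheses (sG : Defs.sub_sigma_algebra G) (mX : measurable_fun setT X)
  (X0 : forall w, 0 <= X w) (Xh : is_cond_exp P G X h).
Let GT : measurableType G.-sigma := g_sigma_algebraType G.

Let mh : measurable_fun setT h.
Proof. by case: Xh => Gh _ _; exact: (G_measurable_measurable sG). Qed.

Let h0 w : (0 <= h w)%E.
Proof. by case: Xh. Qed.

Let mXE : measurable_fun setT (EFin \o X).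
Proof. exact/measurable_EFinP. Qed.

Import HBNNSimple.

(** The right-hand side sees [k] only through its integrals over level sets of [u], which belong to
    [G]; these integrals agree for [h] and for [X]. *)
Let integral_nnsfunM (u : {nnsfun GT >-> R}) (k : T -> \bar R) :
    measurable_fun setT k -> (forall w, 0 <= k w)%E ->
  (\int[P]_w ((u w)%:E * k w) =
   \sum_(r \in range u) (r%:E * \int[P]_(w in u @^-1` [set r]) k w))%E.
Proof.
move=> mk k0.
have mu r : measurable (u @^-1` [set r] : set T).
  apply: (sub_sigma_measurable sG); rewrite -(g_sigma_measurableE sG).
  by rewrite -[X in measurable X]setTI; exact: (@measurable_funP _ _ _ _ _ u).
(* Off the range of [u] the coefficient is set to [0], so that the summand is non-negative for every
   [r], as termwise integration asks. *)
have mf r : measurable_fun setT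
    (fun w : T => (if r \in range u then r else 0)%:E * (\1_(u @^-1` [set r] : set T) w)%:E * k w)%E.
  apply: emeasurable_funM => //. apply: measurable_funeM.
  by apply/measurable_EFinP; exact: measurable_indic.
have r0 r : 0 <= (if r \in range u then r else 0).
  by case: ifPn => // /set_mem[w _ <-].
transitivity (\int[P]_w (\sum_(r \in range u)
  ((if r \in range u then r else 0)%:E * (\1_(u @^-1` [set r] : set T) w)%:E * k w)))%E.
  apply: eq_integral => w _.
  rewrite [in LHS]fimfunE -fsumEFin// ge0_mule_fsuml; last first.
    move=> r; rewrite indicE; case: (boolP (w \in _)) => [|_].
      by move=> /set_mem /= <-; rewrite mulr1 lee_fin.
    by rewrite mulr0.
  by apply: eq_fsbigr => r ru; rewrite ru EFinM.
rewrite ge0_integral_fsum//; last first.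
  by move=> r w _; rewrite !mule_ge0// lee_fin.
apply: eq_fsbigr => r ru; rewrite ru.
under eq_integral do rewrite -muleA.
rewrite ge0_integralZl//; last 3 first.
- apply: emeasurable_funM => //.
  by apply/measurable_EFinP; exact: measurable_indic.
- by move=> w _; rewrite mule_ge0// lee_fin.
- by have := r0 r; rewrite ru lee_fin.
congr (_ * _)%E; rewrite [in RHS]integral_mkcond; apply: eq_integral => w _.
by rewrite indicE patchE; case: ifPn; rewrite ?mul1e ?mul0e.
Qed.

(** Level sets settle the case of simple functions; the [G]-measurable simple functions [v n]
    increase to [u], and monotone convergence carries the identity to [u] on both sides. *)
Lemma cond_exp_mull (u : T -> R) : G_measurable G u -> (forall w, 0 <= u w) ->
  (\int[P]_w ((u w)%:E * h w) = \int[P]_w ((u w)%:E * (X w)%:E))%E.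
Proof.
move=> Gu u0.
have muG : measurable_fun (setT : set GT) (EFin \o u : GT -> \bar R).
  by apply/measurable_EFinP; exact/(G_measurableP sG).
pose v := nnsfun_approx (@measurableT _ GT) muG.
have mv n : measurable_fun setT (v n : T -> R).
  apply: (G_measurable_measurable sG); apply/(G_measurableP sG).
  exact: (@measurable_funP _ _ _ _ _ (v n)).
have cvg_int (k : T -> \bar R) : measurable_fun setT k -> (forall w, 0 <= k w)%E ->
    (\int[P]_w ((v n w)%:E * k w))%E @[n --> \oo] --> (\int[P]_w ((u w)%:E * k w))%E.
  move=> mk k0.
  have -> : (\int[P]_w ((u w)%:E * k w))%E =
      (\int[P]_w (limn (fun n => (v n w)%:E * k w)))%E.
    apply: eq_integral => w _; apply/esym/cvg_lim => //.
    have vu : (EFin \o v ^~ w) n @[n --> \oo] --> (u w)%:E.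
      by apply: (@cvg_nnsfun_approx _ GT R setT measurableT (EFin \o u) muG) => // ? _; rewrite lee_fin.
    have [u0w|u0w] := eqVneq (u w) 0.
      have v0 n : v n w = 0.
        apply/eqP; rewrite eq_le fun_ge0 andbT -lee_fin -u0w -(cvg_lim _ vu)//.
        apply: lime_ge; first by apply/cvg_ex; eexists; exact: vu.
        near=> m; rewrite /= lee_fin.
        have nm : (n <= m)%N by near: m; exists n.
        by have /lefP := nd_nnsfun_approx (@measurableT _ GT) muG nm; apply.
      rewrite u0w mul0e; apply: cvg_near_cst; apply: nearW => n.
      by rewrite v0 mul0e.
    apply: cvgeM vu _; last exact: cvg_cst.
    by rewrite mule_defE eqe (negbTE u0w) andbF.

  apply: (@cvg_monotone_convergence _ T R P setT measurableT
    (fun n w => (v n w)%:E * k w)%E).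
  - move=> n; apply: emeasurable_funM => //.
    exact/measurable_EFinP.
  - by move=> n w _; rewrite mule_ge0// lee_fin.
  - move=> w _ m n mn; rewrite lee_wpmul2r// lee_fin.
    by have /lefP := nd_nnsfun_approx (@measurableT _ GT) muG mn; apply.
apply: (cvg_unique _ (cvg_int _ mh h0)) => //.
rewrite (_ : (fun n => _) = (fun n => \int[P]_w ((v n w)%:E * (X w)%:E)))%E.
  by apply: cvg_int => // w; rewrite lee_fin.
apply/funext => n; rewrite !integral_nnsfunM//.
apply: eq_fsbigr => r _; congr (_ * _)%E.
case: Xh => _ _; apply.
rewrite -(g_sigma_measurableE sG) -[X in measurable X]setTI.
exact: (@measurable_funP _ _ _ _ _ (v n)).
Unshelve. all: by end_near. Qed.

End conditional_expectation.

(** * Pointwise inequalities for one step of the process *)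

Section one_step_inequalities.
Context (R : realType).
Implicit Types a b c e z v B : R.

(** The derivative [2 (z - B)^+] of the squared positive part is 2-Lipschitz, so the first-order
    expansion at [z] errs by at most [(z' - z)^2]. The term [2 s z] is moved to the left to avoid a
    subtraction under the integral. *)
Lemma sqr_pospart_increment B b z z' :
  `|z' - z| <= b * (z + 1) ->
  dist0B B z' ^+ 2 + 2 * dist0B B z * z <=
  dist0B B z ^+ 2 + b ^+ 2 * (z + 1) ^+ 2 + 2 * dist0B B z * z'.
Proof.
rewrite -exprMn => hb; set q := b * (z + 1) in hb *.
have : (z' - z) ^+ 2 <= q ^+ 2.
  rewrite -[leLHS]real_normK ?num_real//.
  by rewrite ler_pXn2r// nnegrE (le_trans _ hb).
rewrite /dist0B; case: (lerP (z - B) 0) => zB; case: (lerP (z' - B) 0) => zB' hq; nra.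
Qed.

(** Below [B] only the error [b^2 (z + 1)^2 <= b^2 (B + 1)^2] is left. Above [B], the drift pays for
    the decrement [2 c s^2 e'], while [(z + 1)^2] and [2 s z] are both at most
    [2 (B + 1)^2 (s^2 + 1)], so the passage from [e] to [e'] absorbs the terms in [a] and [b^2]. *)
Lemma drift_bound B a b c e e' z v : 0 <= B -> 0 <= a -> 0 <= z -> 0 <= e' ->
  e' * (1 + 2 * (B + 1) ^+ 2 * (a + b ^+ 2)) <= e ->
  (z > B -> v <= - (c * (z - B))) ->
  e' * (dist0B B z ^+ 2 + 1 + b ^+ 2 * (z + 1) ^+ 2)
    + 2 * c * dist0B B z ^+ 2 * e' + 2 * e' * dist0B B z * ((1 + a) * z + v)
  <= e * (dist0B B z ^+ 2 + 1) + 2 * e' * dist0B B z * z.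
Proof.
move=> B0 a0 z0 e'0 ee' hv; rewrite /dist0B.
case: (lerP (z - B) 0) => zB.
  rewrite expr0n/= !(mulr0, mul0r, add0r, addr0).
  have zB2 : (z + 1) ^+ 2 <= (B + 1) ^+ 2.
    by rewrite ler_pXn2r// ?nnegrE; lra.
  have b2 : 0 <= b ^+ 2 by exact: sqr_ge0.
  have h1 : b ^+ 2 * (z + 1) ^+ 2 <= 2 * (B + 1) ^+ 2 * (a + b ^+ 2).
    have D0 : 0 <= (B + 1) ^+ 2 by exact: sqr_ge0.
    have := ler_wpM2l b2 zB2; have := mulr_ge0 a0 D0; have := mulr_ge0 b2 D0; lra.
  have := ler_wpM2l e'0 h1; lra.
have {hv} hv : v <= - (c * (z - B)) by apply: hv; lra.
set s := z - B in hv zB *.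
have -> : z = s + B by rewrite /s; ring.
set D := B + 1 in ee'.
have D1 : 1 <= D by rewrite /D; lra.
have b2 : 0 <= b ^+ 2 by exact: sqr_ge0.
have D20 : 0 <= D ^+ 2 - 1 by nra.
have s20 : 0 <= s ^+ 2 by exact: sqr_ge0.
have Ds := mulr_ge0 D20 s20.
have h1 : (s + B + 1) ^+ 2 <= 2 * D ^+ 2 * (s ^+ 2 + 1).
  have -> : s + B + 1 = s + D by rewrite /D; ring.
  have := sqr_ge0 (D - s); nra.
have h2 : 2 * s * (s + B) <= 2 * D ^+ 2 * (s ^+ 2 + 1).
  have -> : s + B = s + D - 1 by rewrite /D; ring.
  have := sqr_ge0 (D - s); nra.
have h3 : b ^+ 2 * (s + B + 1) ^+ 2 + a * (2 * s * (s + B)) <=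
    2 * D ^+ 2 * (a + b ^+ 2) * (s ^+ 2 + 1).
  have := ler_wpM2l b2 h1; have := ler_wpM2l a0 h2; lra.
have h4 := ler_wpM2l e'0 h3.
have h5 : e' * s * (c * s + v) <= 0.
  have cs : c * s + v <= 0 by lra.
  by rewrite mulr_ge0_le0 ?mulr_ge0// ?ltW.
have h6 : e' * (1 + 2 * D ^+ 2 * (a + b ^+ 2)) * (s ^+ 2 + 1) <= e * (s ^+ 2 + 1).
  by rewrite ler_wpM2r//; lra.
nra.
Qed.

End one_step_inequalities.

Ltac measurability := repeat first
  [ assumption | exact: measurable_cst | exact: measurable_id
  | apply: measurable_indic | apply: measurable_maxr | apply: measurable_funX
  | apply: measurable_funB | apply: measurable_funD | apply: measurable_funM ].

(** * The one-step supermartingale inequality, integrated over events of [G] *)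

Section one_step.
Context d (T : measurableType d) (R : realType) (P : probability T R).
Variables (G : set (set T)) (B : R) (z z' a b c v e e' : T -> R) (h : T -> \bar R).
Hypotheses (sG : Defs.sub_sigma_algebra G) (Gz : G_measurable G z)
  (Gb : G_measurable G b) (Gc : G_measurable G c) (Ge : G_measurable G e) (Ge' : G_measurable G e')
  (mz' : measurable_fun setT z') (zh : is_cond_exp P G z' h).
Hypotheses (B0 : 0 <= B) (z0 : forall w, 0 <= z w) (z'0 : forall w, 0 <= z' w)
  (a0 : forall w, 0 <= a w) (c0 : forall w, 0 <= c w) (e0 : forall w, 0 <= e w)
  (e'0 : forall w, 0 <= e' w) (e'1 : forall w, e' w <= 1).
Hypotheses
  (h_le : {ae P, forall w, (h w <= ((1 + a w) * z w + v w)%:E)%E})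
  (incr : {ae P, forall w, `|z' w - z w| <= b w * (z w + 1)})
  (drift : forall w, z w > B -> v w <= - (c w * (z w - B)))
  (ee' : forall w, e' w * (1 + 2 * (B + 1) ^+ 2 * (a w + b w ^+ 2)) <= e w).
Let s w := dist0B B (z w).
Let s' w := dist0B B (z' w).
Let L w := e' w * (s' w ^+ 2 + 1) + 2 * c w * s w ^+ 2 * e' w.
Let V w := e w * (s w ^+ 2 + 1).

Let mea (f : T -> R) : G_measurable G f -> measurable_fun setT f.
Proof. exact: G_measurable_measurable. Qed.

Let s0 w : 0 <= s w.
Proof. by rewrite /s /dist0B le_max lexx orbT. Qed.

Let ms : measurable_fun setT s.
Proof. have := mea Gz => ?; rewrite /s /dist0B; measurability. Qed.

Let ms' : measurable_fun setT s'.
Proof. rewrite /s' /dist0B; measurability. Qed.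

Let mL : measurable_fun setT (EFin \o L).
Proof.
move: (mea Ge') (mea Gc) => ? ?.
by apply/measurable_EFinP; rewrite /L; measurability.
Qed.

Let mV : measurable_fun setT (EFin \o V).
Proof.
by move: (mea Ge) => ?; apply/measurable_EFinP; rewrite /V; measurability.
Qed.

Let L0 w : 0 <= L w.
Proof. by rewrite addr_ge0 ?mulr_ge0 ?addr_ge0 ?sqr_ge0. Qed.

Let V0 w : 0 <= V w.
Proof. by rewrite mulr_ge0 ?addr_ge0 ?sqr_ge0. Qed.

(* The term [2 e' s z] is added to both sides so that only integrals of
   non-negative functions occur; cancelling it needs [z] bounded on [A]. *)
Let step_bounded (K : R) (A : set T) : G A -> (forall w, A w -> z w <= K) ->
  (\int[P]_(w in A) (L w)%:E <= \int[P]_(w in A) (V w)%:E)%E.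
Proof.
move=> GA zK.
have mA : measurable A by exact: (sub_sigma_measurable sG).
have sub (f : T -> \bar R) : measurable_fun setT f -> measurable_fun A f.
  exact: measurable_funTS.
move: (mea Ge) (mea Ge') (mea Gc) (mea Gz) (mea Gb) => me me' mc mz mb.
pose k w := 2 * e' w * s w.
pose M w := k w * z w.
pose q w := e' w * (s w ^+ 2 + 1 + b w ^+ 2 * (z w + 1) ^+ 2)
            + 2 * c w * s w ^+ 2 * e' w.
have k0 w : 0 <= k w by rewrite !mulr_ge0.
have M0 w : 0 <= M w by rewrite mulr_ge0.
have q0 w : 0 <= q w by rewrite addr_ge0 ?mulr_ge0 ?addr_ge0 ?sqr_ge0// mulr_ge0 ?sqr_ge0.
have mk : measurable_fun setT k by rewrite /k; measurability.
have mM : measurable_fun setT (EFin \o M).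
  by apply/measurable_EFinP; rewrite /M; measurability.
have mq : measurable_fun setT (EFin \o q).
  by apply/measurable_EFinP; rewrite /q; measurability.
have mkz' : measurable_fun setT (fun w => (k w)%:E * (z' w)%:E)%E.
  by apply: emeasurable_funM; apply/measurable_EFinP.
have [Gh h0 _] := zh.
have mh : measurable_fun setT h by exact: (G_measurable_measurable sG).
have mkh : measurable_fun setT (fun w => (k w)%:E * h w)%E.
  by apply: emeasurable_funM => //; apply/measurable_EFinP.
(* On [A] one has [M <= 2 K^2], because [e' <= 1] and [s <= z <= K]. *)
have Mfin : (\int[P]_(w in A) (M w)%:E)%E \is a fin_num.
  rewrite ge0_fin_numE; last by apply: integral_ge0 => w _; rewrite lee_fin.
  apply: (@le_lt_trans _ _ (\int[P]_(w in A) (2 * K ^+ 2)%:E)%E).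
    apply: ge0_le_integral => //.
    - by move=> w _; rewrite lee_fin.
    - exact: sub.
    - move=> w Aw; rewrite lee_fin /M /k.
      have zKw := zK w Aw.
      have sz : s w <= z w by rewrite /s /dist0B ge_max z0 andbT gerBl.
      have h1 : s w * z w <= K ^+ 2 by rewrite expr2 ler_pM// (le_trans sz).
      have h2 : e' w * (s w * z w) <= s w * z w by rewrite ler_piMl// mulr_ge0.
      lra.
  rewrite integral_cst//; apply: lte_mul_pinfty => //.
    by rewrite lee_fin mulr_ge0 ?sqr_ge0.
  exact: le_lt_trans (probability_le1 P mA) (ltry 1).
(* The indicator of [A] is absorbed into the [G]-measurable factor, so that [cond_exp_mull] applies
   on the whole space. *)
have intk (g : T -> \bar R) :
    (\int[P]_(w in A) ((k w)%:E * g w) =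
     \int[P]_w ((\1_A w * k w)%:E * g w))%E.
  rewrite integral_mkcond; apply: eq_integral => w _.
  by rewrite patchE indicE; case: ifPn; rewrite ?mul1r ?mul0r ?mul0e.
have Gk : G_measurable G (fun w => \1_A w * k w).
  apply/(G_measurableP sG).
  have toG (f : T -> R) := (G_measurableP sG f).1.
  move: (toG _ Ge') (toG _ Gz) => ? ?.
  have ? : measurable (A : set (g_sigma_algebraType G)).
    by rewrite (g_sigma_measurableE sG).
  rewrite /k /s /dist0B; measurability.
have kzh : (\int[P]_(w in A) ((k w)%:E * (z' w)%:E) = \int[P]_(w in A) ((k w)%:E * h w))%E.
  rewrite !intk; apply/esym; apply: (cond_exp_mull sG mz' z'0 zh Gk).
  by move=> w; rewrite mulr_ge0// indicE.
have [kz'0 kh0] : (forall w, 0 <= (k w)%:E * (z' w)%:E)%E /\ (forall w, 0 <= (k w)%:E * h w)%E.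
  by split=> w; rewrite mule_ge0// lee_fin.
have nn (f : T -> R) w : 0 <= f w -> (0 <= (EFin \o f) w)%E by rewrite lee_fin.
have DLM : (\int[P]_(w in A) ((L w)%:E + (M w)%:E) =
    \int[P]_(w in A) (L w)%:E + \int[P]_(w in A) (M w)%:E)%E.
  by apply: ge0_integralD => //; solve [exact: sub | move=> w _; exact: nn].
have DVM : (\int[P]_(w in A) ((V w)%:E + (M w)%:E) =
    \int[P]_(w in A) (V w)%:E + \int[P]_(w in A) (M w)%:E)%E.
  by apply: ge0_integralD => //; solve [exact: sub | move=> w _; exact: nn].
rewrite -(leeD2rE _ _ Mfin) -DLM -DVM.
(* Convexity gives [L + M <= q + k z']; then [z'] is exchanged for [h] under the integral, and the
   bound on [h] with [drift_bound] gives [q + k h <= V + M]. *)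
apply: (@le_trans _ _ (\int[P]_(w in A) ((q w)%:E + (k w)%:E * (z' w)%:E))%E).
  apply: ae_ge0_le_integral => //.
  - by move=> w _; rewrite -EFinD lee_fin addr_ge0.
  - by apply: emeasurable_funD; exact: sub.
  - by move=> w _; rewrite adde_ge0// lee_fin.
  - by apply: emeasurable_funD; exact: sub.
  apply: filterS incr => w hb _; rewrite -EFinM -!EFinD lee_fin /L /M /q /k.
  have := ler_wpM2l (e'0 w) (sqr_pospart_increment B hb); rewrite -/(s w) -/(s' w); lra.
rewrite ge0_integralD//; last 3 first.
- by move=> w _; exact: nn.
- exact: sub.
- exact: sub.
rewrite kzh -ge0_integralD//; last 3 first.
- by move=> w _; exact: nn.
- exact: sub.
- exact: sub.
apply: ae_ge0_le_integral => //.
- by move=> w _; rewrite adde_ge0// lee_fin.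
- by apply: emeasurable_funD; exact: sub.
- by move=> w _; rewrite -EFinD lee_fin addr_ge0.
- by apply: emeasurable_funD; exact: sub.
apply: filterS h_le => w hw _.
apply: (@le_trans _ _ ((q w)%:E + (k w)%:E * ((1 + a w) * z w + v w)%:E)%E).
  by rewrite leeD2l// lee_wpmul2l// lee_fin.
rewrite -EFinM -!EFinD lee_fin.
exact: (drift_bound B0 (a0 w) (z0 w) (e'0 w) (ee' w) (@drift w)).
Qed.

(** The events [z <= n] lie in [G], make [z] bounded and exhaust the space; the bounded case passes
    to the limit by monotone convergence. *)
Lemma one_step (A : set T) : G A ->
  (\int[P]_(w in A) (e' w * (dist0B B (z' w) ^+ 2 + 1)
      + 2 * c w * dist0B B (z w) ^+ 2 * e' w)%:E
   <= \int[P]_(w in A) (e w * (dist0B B (z w) ^+ 2 + 1))%:E)%E.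
Proof.
move=> GA.
pose E (n : nat) := A `&` [set w | z w <= n%:R].
have GE n : G (E n).
  apply: (sub_sigmaI sG) => //.
  rewrite (_ : [set w | _] = z @^-1` `]-oo, n%:R]); first exact: Gz.
  by apply/seteqP; split=> w; rewrite /= in_itv.
have mE n : measurable (E n) by exact: (sub_sigma_measurable sG).
have AE : A = \bigcup_n E n.
  apply/seteqP; split=> [w Aw|w [n _ []//]].
  by exists (Num.truncn (z w)).+1 => //; split=> //=; rewrite ltW// truncnS_gt.
have ndE : {homo E : m n / (m <= n)%N >-> (m <= n)%O}.
  move=> m n mn; apply/subsetPset => w [Aw /= zm]; split=> //=.
  by rewrite (le_trans zm)// ler_nat.
have cvgE (f : T -> R) : measurable_fun setT (EFin \o f) -> (forall w, 0 <= f w) ->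
    (\int[P]_(w in E n) (f w)%:E)%E @[n --> \oo] --> (\int[P]_(w in A) (f w)%:E)%E.
  move=> mf f0; rewrite AE; apply: ge0_nondecreasing_set_cvg_integral => //.
    by move=> n; exact: measurable_funTS.
  by move=> n w _; rewrite lee_fin.
have [cL cV] := (cvgE L mL L0, cvgE V mV V0).
rewrite -[leLHS](cvg_lim _ cL)// -[leRHS](cvg_lim _ cV)//.
apply: lee_lim; [exact: cvgP cL | exact: cvgP cV | apply: nearW => n].
by apply: (@step_bounded n%:R) => // w [].
Qed.

End one_step.

(** * A maximal inequality for the return to [eps] after a visit below [delta] *)

Section crossing.
Context d (T : measurableType d) (R : realType) (P : probability T R).
Variables (F : nat -> set (set T)) (W e : nat -> T -> R) (delta eps : R).
Hypotheses (fF : filtration F) (FW : adapted F W) (Fe : adapted F e)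
  (W0 : forall n w, 0 <= W n w) (e0 : forall n w, 0 <= e n w)
  (e_le : forall n w, e n.+1 w <= e n w) (delta0 : 0 < delta) (delta_eps : delta < eps).
Hypothesis step : forall n A, F n A ->
  (\int[P]_(w in A) (W n.+1 w + e n.+1 w)%:E <= \int[P]_(w in A) (W n w + e n w)%:E)%E.

(* [Some false]: [W] has not yet been at most [delta]; [Some true]: it has, and has
   stayed below [eps] since; [None]: it has come back to [eps] (absorbing). *)
Fixpoint crossing_state (n : nat) (w : T) : option bool :=
  if n is m.+1 then
    if crossing_state m w is Some active then
      if active then if W n w < eps then Some true else None
      else Some (W n w <= delta)
    else None
  else Some (W 0%N w <= delta).

Let F_sub n : Defs.sub_sigma_algebra (F n).
Proof. exact: fF.1. Qed.

Lemma crossing_state_adapted n s : F n [set w | crossing_state n w = s].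
Proof.
have FC m A : F m A -> F m (~` A).
  by rewrite -!(g_sigma_measurableE (F_sub m)); exact: measurableC.
have Fle m : F m [set w | W m w <= delta].
  rewrite (_ : [set w | _] = W m @^-1` `]-oo, delta]); first exact: FW.
  by apply/seteqP; split=> w; rewrite /= in_itv.
have Flt m : F m [set w | W m w < eps].
  rewrite (_ : [set w | _] = W m @^-1` `]-oo, eps[); first exact: FW.
  by apply/seteqP; split=> w; rewrite /= in_itv.
have Fb m A c : F m A -> F m (if c then A else ~` A) by case: c => // /FC.
elim: n s => [|n IH] s.
  case: s => [s|]; last first.
    rewrite (_ : [set w | _] = ~` setT) ?setCT; last by apply/seteqP; split.
    by rewrite -setCT; apply: FC; exact: sub_sigmaT.
  rewrite (_ : [set w | _] = if s then [set w | W 0%N w <= delta]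
    else ~` [set w | W 0%N w <= delta]); first exact: Fb.
  by case: s; apply/seteqP; split=> w /=; case: (W 0%N w <= delta).
have {}IH t : F n.+1 [set w | crossing_state n w = t] by exact: (fF.2 n).
have FU := sub_sigmaU (F_sub n.+1); have FI := sub_sigmaI (F_sub n.+1).
set S := fun t => [set w | crossing_state n w = t] in IH.
pose D := [set w | W n.+1 w <= delta]; pose E := [set w | W n.+1 w < eps].
rewrite (_ : [set w | _] = match s with
  | None => S None `|` (S (Some true) `&` ~` E)
  | Some true => (S (Some true) `&` E) `|` (S (Some false) `&` D)
  | Some false => S (Some false) `&` ~` D end).
  by case: s => [[]|]; [apply: FU; apply: FI | apply: FI | apply: FU; [exact: IH|apply: FI]];
     first [exact: IH | exact: Fle | exact: Flt | apply: FC].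
apply/seteqP; rewrite /S /D /E; split=> w; case: s => [[]|];
  rewrite /setU /setI /setC /mkset /=;
  case: (crossing_state n w) => [[]|]; case: (W n.+1 w < eps);
  case: (W n.+1 w <= delta); rewrite /is_true; intuition congruence.
Qed.

(** This follows [W] while the state is active and is frozen at [eps] after the return; before the
    visit it is [delta], which dominates [W] at the visit. *)
Let pot (s : option bool) (x : R) :=
  match s with None => eps | Some false => delta | Some true => x end.

(** The summand [e] is there because [step] controls [W + e] rather than [W]. *)
Let M n w := pot (crossing_state n w) (W n w) + e n w.

Let M0 n w : 0 <= M n w.
Proof.
rewrite addr_ge0// /pot; case: (crossing_state n w) => [[]|] //; first exact: ltW.
by rewrite ltW// (lt_trans delta0).
Qed.

Let mset n s : measurable [set w | crossing_state n w = s].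
Proof. by apply: (sub_sigma_measurable (F_sub n)); exact: crossing_state_adapted. Qed.

Let mem_state n s w :
  (w \in [set w | crossing_state n w = s]) = (crossing_state n w == s).
Proof. by apply/idP/eqP; rewrite in_setE. Qed.

Let mFun (u : nat -> T -> R) n : adapted F u -> measurable_fun setT (u n).
Proof. by move=> Fu; exact: (G_measurable_measurable (F_sub n)). Qed.

Let mM n : measurable_fun setT (EFin \o M n).
Proof.
have -> : M n = fun w => \1_[set w | crossing_state n w = None] w * eps
    + \1_[set w | crossing_state n w = Some false] w * delta
    + \1_[set w | crossing_state n w = Some true] w * W n w + e n w.
  apply/funext => w; rewrite /M /pot !indicE !mem_state.
  by case: (crossing_state n w) => [[]|] /=; lra.
have ? := mFun n FW; have ? := mFun n Fe.
apply/measurable_EFinP; measurability; exact: mset.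
Qed.

(** On active paths [step] applies, and a return to [eps] only replaces some [W >= eps] by [eps]. On
    the other paths the potential cannot grow, as a visit exchanges [delta] for some [W <= delta],
    and [e] is non-increasing. *)
Let M_step n :
  (\int[P]_w (M n.+1 w)%:E <= \int[P]_w (M n w)%:E)%E.
Proof.
pose A := [set w | crossing_state n w = Some true].
have mA : measurable A by exact: mset.
have split_int m : (\int[P]_w (M m w)%:E =
    \int[P]_(w in A) (M m w)%:E + \int[P]_(w in ~` A) (M m w)%:E)%E.
  rewrite -ge0_integral_setU//.
  - by rewrite setUv.
  - exact: measurableC.
  - by apply: measurable_funTS; exact: mM.
  - by move=> w _; rewrite lee_fin.
  - by rewrite disj_set2E setICr.
have mWe m : measurable_fun setT (fun w => (W m w + e m w)%:E).
  apply/measurable_EFinP.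
  have ? := mFun m FW; have ? := mFun m Fe; measurability.
rewrite !split_int; apply: leeD.
  apply: le_trans.
    apply: (@ge0_le_integral _ _ _ P A mA _ (fun w => (W n.+1 w + e n.+1 w)%:E)).
    - by move=> w _; rewrite lee_fin.
    - by apply: measurable_funTS; exact: mM.
    - by apply: measurable_funTS; exact: mWe.
    - move=> w; rewrite /A /= => Aw; rewrite lee_fin /M /= Aw lerD2r.
      by case: (ltP (W n.+1 w)).
  apply: le_trans; first exact: (step (crossing_state_adapted n (Some true))).
  rewrite le_eqVlt; apply/orP; left; apply/eqP.
  by apply: eq_integral => w; rewrite inE /A /= => Aw; rewrite /M Aw.
apply: ge0_le_integral.
- exact: measurableC.
- by move=> w _; rewrite lee_fin.
- by apply: measurable_funTS; exact: mM.
- by apply: measurable_funTS; exact: mM.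
- move=> w; rewrite /A /= => Aw; rewrite lee_fin /M /=.
  rewrite lerD//; case: (crossing_state n w) Aw => [[]|]//= _.
  by case: (leP (W n.+1 w)).
Qed.

(** A Markov-type bound: the mean of [M n] dominates the left-hand side, and [M 0] is at most
    [delta + e 0]. *)
Lemma crossing_ineq n :
  (eps%:E * P [set w | crossing_state n w = None] + \int[P]_w (e n w)%:E
   <= delta%:E + \int[P]_w (e 0%N w)%:E)%E.
Proof.
have me m : measurable_fun setT (fun w => (e m w)%:E).
  by apply/measurable_EFinP; exact: mFun.
have mH := mset n None.
have eps0 : 0 <= eps by rewrite ltW// (lt_trans delta0).
apply: (@le_trans _ _ (\int[P]_w (M n w)%:E)%E).
  rewrite -[X in P X]setIT -integral_indic// -ge0_integralZl//; last first.
    by apply/measurable_EFinP; exact: measurable_indic.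
  rewrite -ge0_integralD//; last 3 first.
  - by move=> w _; rewrite mule_ge0// lee_fin.
  - apply: measurable_funeM; apply/measurable_EFinP; exact: measurable_indic.
  - by move=> w _; rewrite lee_fin.
  apply: ge0_le_integral => //.
  - by move=> w _; rewrite adde_ge0// ?mule_ge0// lee_fin.
  - apply: emeasurable_funD => //; apply: measurable_funeM.
    by apply/measurable_EFinP; exact: measurable_indic.
  - exact: mM.
  - move=> w _; rewrite -EFinM -EFinD lee_fin /M lerD2r indicE mem_state /pot.
    case: (crossing_state n w) => [[]|] /=; rewrite ?mulr0 ?mulr1//; exact: ltW.
apply: (@le_trans _ _ (\int[P]_w (M 0%N w)%:E)%E).
  by elim: n {mH} => // n IH; exact: le_trans (M_step n) IH.
have -> : delta%:E = (\int[P]_w (cst delta%:E w))%E.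
  by rewrite integral_cst//= probability_setT mule1.
rewrite -ge0_integralD//; last 2 first.
- by move=> w _; rewrite lee_fin ltW.
- by move=> w _; rewrite lee_fin.
apply: ge0_le_integral => //.
- by move=> w _; rewrite lee_fin.
- exact: mM.
- exact: emeasurable_funD.
- move=> w _; rewrite /cst -EFinD lee_fin /M lerD2r /=.
  by case: (leP (W 0%N w)).
Qed.

Lemma crossing_state_None n w : crossing_state n w = None ->
  crossing_state n.+1 w = None.
Proof. by move=> /= ->. Qed.

(** If the state were never [None], it would be active at all times from [j] on, which forces
    [W < eps] at time [n]. *)
Lemma crossing_hit w j n : W j w <= delta -> (j <= n)%N -> eps <= W n w ->
  exists m, crossing_state m w = None.
Proof.
move=> Wj jn Wn; apply: contrapT => /forallNP never.
have act k : (j <= k)%N -> crossing_state k w = Some true.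
  elim: k => [|k IH]; first by rewrite leqn0 => /eqP j0; rewrite j0 in Wj; rewrite /= Wj.
  rewrite leq_eqVlt => /predU1P[jk|]; last first.
    rewrite ltnS => /IH /= kw; have := never k.+1; rewrite /= kw.
    by case: ifP.
  have := never k; have := never k.+1; rewrite /= -jk Wj.
  case: (crossing_state k w) => [[]|]//=.
  by rewrite (le_lt_trans Wj delta_eps).
have nw := act _ jn.
case: n => [|n] in jn Wn nw *.
  move: jn; rewrite leqn0 => /eqP j0; rewrite j0 in Wj.
  by have := le_trans Wn Wj; rewrite leNgt delta_eps.
move: nw => /=; case: (crossing_state n w) => [[]|]//.
  by rewrite ltNge Wn.
by case=> /(le_trans Wn); rewrite leNgt delta_eps.
Qed.

End crossing.

(** * Almost sure convergence to zero of a process that is frequently small *)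

Section supermartingale_limit.
Context d (T : measurableType d) (R : realType) (P : probability T R).
Variables (F : nat -> set (set T)) (W e : nat -> T -> R).
Hypotheses (fF : filtration F) (FW : adapted F W) (Fe : adapted F e)
  (W0 : forall n w, 0 <= W n w) (e0 : forall n w, 0 <= e n w)
  (e1 : forall n w, e n w <= 1) (e_le : forall n w, e n.+1 w <= e n w).
Hypothesis step : forall n A, F n A ->
  (\int[P]_(w in A) (W n.+1 w + e n.+1 w)%:E <= \int[P]_(w in A) (W n w + e n w)%:E)%E.

Let E n := fine (\int[P]_w (e n w)%:E)%E.

Let me n : measurable_fun setT (fun w => (e n w)%:E).
Proof. by apply/measurable_EFinP; exact: (G_measurable_measurable (fF.1 n)). Qed.

Let int_ge0 n : (0 <= \int[P]_w (e n w)%:E)%E.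
Proof. by apply: integral_ge0 => w _; rewrite lee_fin. Qed.

Let EE n : (\int[P]_w (e n w)%:E)%E = (E n)%:E.
Proof.
rewrite fineK// ge0_fin_numE//.
apply: (@le_lt_trans _ _ (\int[P]_w (cst 1%:E w))%E).
  by apply: ge0_le_integral => // w _; rewrite lee_fin.
by rewrite integral_cst//= probability_setT mule1 ltry.
Qed.

Let E_nonincr : nonincreasing_seq E.
Proof.
apply/nonincreasing_seqP => n; rewrite -lee_fin -!EE.
by apply: ge0_le_integral => // w _; rewrite lee_fin.
Qed.

Let E_ge0 n : 0 <= E n.
Proof. by rewrite -lee_fin -EE. Qed.

Let E_cvg : cvgn E.
Proof.
apply: nonincreasing_is_cvgn => //.
by exists 0 => _ [n _ <-].
Qed.

Let E_ge n : limn E <= E n.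
Proof. exact: nonincreasing_cvgn_ge. Qed.

Let hit (delta eps : R) (N : nat) :=
  \bigcup_n [set w | crossing_state (fun m => W (m + N)%N) delta eps n w = None].

Let fF_shift N : filtration (fun n => F (n + N)%N).
Proof. by split=> n; [exact: fF.1 | exact: (fF.2 (n + N)%N)]. Qed.

Let mhit1 delta eps N n :
  measurable [set w | crossing_state (fun m => W (m + N)%N) delta eps n w = None].
Proof.
apply: (sub_sigma_measurable (fF.1 (n + N)%N)).
apply: (@crossing_state_adapted _ _ _ (fun n => F (n + N)%N)) => //.
Qed.

(** The crossing inequality is applied to the process started at time [N], where the mean of [e] can
    still lose at most [E N - limn E]; continuity from below then lets the horizon grow. *)
Let hit_le delta eps N : 0 < delta -> delta < eps ->
  (eps%:E * P (hit delta eps N) <= (delta + (E N - limn E))%:E)%E.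
Proof.
move=> delta0 delta_eps.
have eps0 : 0 < eps by exact: lt_trans delta_eps.
rewrite muleC -lee_pdivlMr//.
have hcvg : P [set w | crossing_state (fun m => W (m + N)%N) delta eps n w = None]
    @[n --> \oo] --> P (hit delta eps N).
  apply: nondecreasing_cvg_mu.
  - by move=> n; exact: mhit1.
  - by apply: bigcup_measurable => n _; exact: mhit1.
  - apply/nondecreasing_seqP => n; apply/subsetPset => w /=.
    exact: crossing_state_None.
rewrite -(cvg_lim _ hcvg)//; apply: lime_le; first exact: cvgP hcvg.
apply: nearW => n; rewrite lee_pdivlMr// muleC.
have := @crossing_ineq _ _ _ P (fun n => F (n + N)%N) (fun n => W (n + N)%N)
  (fun n => e (n + N)%N) delta eps (fF_shift N) (fun n => FW (n + N)%N)
  (fun n => Fe (n + N)%N) (fun n => W0 (n + N)%N) (fun n => e0 (n + N)%N)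
  (fun n => e_le (n + N)%N) delta0 delta_eps (fun n => @step (n + N)%N) n.
rewrite !EE add0n -leeBrDr// -!EFinD => /le_trans; apply.
by rewrite lee_fin addrA lerD2l lerN2.
Qed.

(** By [hit_le], a return to a fixed level [eps k] after time [N] from below [delta k N] has
    probability tending to [0], so each [Z k] is null; a frequently small path that does not
    converge to [0] lies in some [Z k]. *)
Lemma ae_cvg0_of_frequently_small :
  {ae P, forall w, (forall delta, 0 < delta -> forall N : nat,
     exists2 n, (N <= n)%N & W n w <= delta) -> W n w @[n --> \oo] --> (0 : R)}.
Proof.
pose eps (k : nat) : R := k.+1%:R^-1.
(* The divisor [N + 2] is at least [2], so [delta k N < eps k] already at [N = 0], and it sends
   [delta k N] to [0]. *)
pose delta k (N : nat) : R := eps k / N.+2%:R.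
pose Z k := \bigcap_N hit (delta k N) (eps k) N.
have eps0 k : 0 < eps k by rewrite invr_gt0.
have delta0 k N : 0 < delta k N by rewrite divr_gt0.
have delta_eps k N : delta k N < eps k.
  by rewrite ltr_pdivrMr// ltr_pMr// ltr1n.
have mhit k N : measurable (hit (delta k N) (eps k) N).
  by apply: bigcup_measurable => n _; exact: mhit1.
have mZ k : measurable (Z k) by apply: bigcap_measurable => // N _; exact: mhit.
have PZ0 k : P (Z k) = 0%E.
  have hle N : ((eps k)%:E * P (Z k) <= (delta k N + (E N - limn E))%:E)%E.
    apply: le_trans (hit_le N (delta0 k N) (delta_eps k N)).
    apply: lee_wpmul2l; first by rewrite lee_fin ltW.
    by apply: le_measure; rewrite ?inE// => w; exact.
  have lim0 : (delta k N + (E N - limn E)) @[N --> \oo] --> (0 : R).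
    rewrite -[X in _ --> X]addr0; apply: cvgD.
      rewrite -(mulr0 (eps k)); apply: cvgMr.
      by move: (@cvg_harmonic R); rewrite -cvg_shiftS.
    by rewrite -(subrr (limn E)); apply: cvgB => //; exact: cvg_cst.
  have PZE : P (Z k) = (fine (P (Z k)))%:E by rewrite fineK// fin_num_measure.
  have : eps k * fine (P (Z k)) <= 0.
    rewrite -(cvg_lim _ lim0)//; apply: limr_ge; first exact: cvgP lim0.
    by apply: nearW => N; rewrite -lee_fin EFinM -PZE; exact: hle.
  rewrite pmulr_rle0// => PZ; apply/eqP; rewrite eq_le measure_ge0 andbT.
  by rewrite PZE lee_fin.
have : {ae P, forall w k, ~ Z k w}.
  apply/ae_foralln => k; exists (Z k); split=> //; first exact: PZ0.
  by move=> w /contrapT.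
apply: filterS => w nZ small; apply/cvgrPdist_lt => r r0.
apply: contrapT => nr.
pose k := Num.truncn r^-1.
have kr : eps k <= r by rewrite -[leRHS]invrK lef_pV2 ?posrE ?invr_gt0// ltW// truncnS_gt.
(* For each [N] the path is below [delta k N] at some [j >= N] and later reaches [r >= eps k], so it
   meets every event of the intersection. *)
apply: (nZ k) => N _.
have [j Nj Wj] := small _ (delta0 k N) N.
have [n jn Wn] : exists2 n, (j <= n)%N & r <= W n w.
  apply: contrapT => h; apply: nr; exists j => // n /= jn.
  rewrite sub0r normrN ger0_norm// ltNge; apply/negP => rW; apply: h.
  by exists n.
have [m hm] : exists m, crossing_state (fun m => W (m + N)%N) (delta k N) (eps k) m w = None.
  apply: (@crossing_hit _ _ _ _ _ _ (delta_eps k N) w (j - N)%N (n - N)%N).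
  - by rewrite subnK.
  - exact: leq_sub2r.
  - by rewrite subnK ?(le_trans kr)// (leq_trans Nj).
by exists m.
Qed.

End supermartingale_limit.

(** * Almost sure summability of the supermartingale decrements *)

(** On the event [V 0 <= K], which lies in every [F n], telescoping bounds the expected sum of the
    [D n] by [K]. The sum is thus almost surely finite there, and these events exhaust the space. *)
Lemma ae_summable_decrements d (T : measurableType d) (R : realType)
    (P : probability T R) (F : nat -> set (set T)) (V D : nat -> T -> R) :
  filtration F -> adapted F V -> (forall n, measurable_fun setT (D n)) ->
  (forall n w, 0 <= V n w) -> (forall n w, 0 <= D n w) ->
  (forall n A, F n A -> (\int[P]_(w in A) (V n.+1 w + D n w)%:E
     <= \int[P]_(w in A) (V n w)%:E)%E) ->
  {ae P, forall w, (\sum_(0 <= k <oo) (D k w)%:E < +oo)%E}.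
Proof.
move=> fF FV mD V0 D0 step.
have mDE n : measurable_fun setT (EFin \o D n) by exact/measurable_EFinP.
have mV n : measurable_fun setT (EFin \o V n).
  by apply/measurable_EFinP; exact: (G_measurable_measurable (fF.1 n)).
have F0n n A : F 0%N A -> F n A by move=> F0A; elim: n => // n; exact: fF.2.
pose A (K : nat) := [set w | V 0%N w <= K%:R].
have F0A K : F 0%N (A K).
  rewrite (_ : A K = V 0%N @^-1` `]-oo, K%:R]); first exact: FV.
  by apply/seteqP; split=> w; rewrite /A /= in_itv.
have mA K : measurable (A K) by exact: (sub_sigma_measurable (fF.1 0%N)).
have telescope K n : (\int[P]_(w in A K) (V n w)%:E
    + \sum_(0 <= k < n) \int[P]_(w in A K) (D k w)%:E
    <= \int[P]_(w in A K) (V 0%N w)%:E)%E.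
  elim: n => [|n IH]; first by rewrite big_nil adde0.
  rewrite big_nat_recr//= addeCA addeC; apply: le_trans IH; apply: leeD2r.
  rewrite -ge0_integralD//.
  - exact: (step n (A K) (F0n n _ (F0A K))).
  - by move=> w _; rewrite lee_fin.
  - by apply: measurable_funTS; exact: mV.
  - by move=> w _; rewrite lee_fin.
  - by apply: measurable_funTS; exact: mDE.
have int_fin K : (\int[P]_(w in A K) \sum_(0 <= k <oo) (D k w)%:E < +oo)%E.
  rewrite integral_nneseries//; last 2 first.
  - by move=> n; apply: measurable_funTS; exact: mDE.
  - by move=> n w _; rewrite lee_fin.
  apply: (@le_lt_trans _ _ K%:R%:E); last exact: ltry.
  apply: lime_le.
    apply: is_cvg_nneseries => n _ _.
    by apply: integral_ge0 => w _; rewrite lee_fin.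
  apply: nearW => n; apply: (@le_trans _ _ (\int[P]_(w in A K) (V 0%N w)%:E)%E).
    apply: le_trans (telescope K n); rewrite leeDr//.
    by apply: integral_ge0 => w _; rewrite lee_fin.
  apply: (@le_trans _ _ (\int[P]_(w in A K) (K%:R)%:E)%E).
    apply: ge0_le_integral => //.
    - by move=> w _; rewrite lee_fin.
    - by apply: measurable_funTS; exact: mV.
  rewrite integral_cst// -[leRHS]mule1; apply: lee_wpmul2l; first by rewrite lee_fin.
  exact: probability_le1.
have : {ae P, forall w (K : nat), A K w -> (\sum_(0 <= k <oo) (D k w)%:E)%E \is a fin_num}.
  apply/ae_foralln => K; apply: integrable_ae => //.
  apply/integrableP; split.
    apply: measurable_funTS; apply: ge0_emeasurable_sum => n.
      by move=> w _ _; rewrite lee_fin.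
    by move=> _; exact: mDE.
  rewrite (eq_integral (fun w => \sum_(0 <= k <oo) (D k w)%:E)%E)//.
  by move=> w _; rewrite gee0_abs// nneseries_ge0// => k _ _; rewrite lee_fin.
apply: filterS => w /(_ (Num.truncn (V 0%N w)).+1) hfin.
by rewrite ltey_eq hfin// /A /= ltW// truncnS_gt.
Qed.

(** * Deterministic arguments along a single path *)

Section pathwise.
Context (R : realType).
Implicit Types a b c phi e s : nat -> R.

Lemma discount_lower_bound a b (C : R) : 0 <= C ->
  (forall k, 0 <= a k) -> (\sum_(0 <= k <oo) (a k)%:E < +oo)%E ->
  (\sum_(0 <= k <oo) (b k ^+ 2)%:E < +oo)%E ->
  exists2 eta : R, 0 < eta & forall n, eta <= expR (- (C * \sum_(k < n) (a k + b k ^+ 2))).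
Proof.
move=> C0 a0.
have b0 k : 0 <= b k ^+ 2 by exact: sqr_ge0.
have bound (u : nat -> R) : (forall k, 0 <= u k) ->
    (\sum_(0 <= k <oo) (u k)%:E < +oo)%E -> exists S : R, forall n, \sum_(k < n) u k <= S.
  move=> u0 uoo; exists (fine (\sum_(0 <= k <oo) (u k)%:E)%E) => n.
  rewrite -lee_fin fineK; last first.
    by rewrite ge0_fin_numE// nneseries_ge0// => k _ _; rewrite lee_fin.
  rewrite -sumEFin -(big_mkord xpredT (fun k => (u k)%:E)).
  by apply: nneseries_lim_ge => k _ _; rewrite lee_fin.
move=> /(bound a a0)[Sa aS] /(bound _ b0)[Sb bS].
exists (expR (- (C * (Sa + Sb)))); first exact: expR_gt0.
by move=> n; rewrite ler_expR lerN2 ler_wpM2l// big_split lerD.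
Qed.

(** If [e phi > delta] from [N] on, then [phi >= delta] there because [e <= 1], and the weighted
    series dominates [delta eta] times a divergent tail of [c]. *)
Lemma frequently_small c phi e (eta : R) : (forall k, 0 <= c k) ->
  (forall k, 0 <= phi k) -> 0 < eta -> (forall k, eta <= e k) -> (forall k, e k <= 1) ->
  (\sum_(0 <= k <oo) (c k)%:E = +oo)%E ->
  (\sum_(0 <= k <oo) (c k * phi k * e k.+1)%:E < +oo)%E ->
  forall delta, 0 < delta -> forall N : nat, exists2 n, (N <= n)%N & e n * phi n <= delta.
Proof.
move=> c0 phi0 eta0 e_eta e1 coo cphi delta delta0 N.
apply: contrapT => h.
have large k : (N <= k)%N -> delta <= phi k.
  move=> Nk; rewrite leNgt; apply/negP => phid; apply: h; exists k => //.
  by rewrite (le_trans _ (ltW phid))// ler_piMl.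
have cphi0 k : 0 <= c k * phi k * e k.+1.
  by rewrite !mulr_ge0// (le_trans (ltW eta0)).
have tail : (\sum_(N <= k <oo) (c k)%:E = +oo)%E.
  have ck0 k : (0 <= k)%N -> (0 <= (c k)%:E)%E by rewrite lee_fin.
  have := nneseries_split 0 N ck0.
  by rewrite add0n coo sumEFin; case: (\sum_(N <= k <oo) (c k)%:E)%E.
move: cphi; rewrite ltNge => /negP; apply.
have : ((delta * eta)%:E * \sum_(N <= k <oo) (c k)%:E <=
    \sum_(N <= k <oo) (c k * phi k * e k.+1)%:E)%E.
  rewrite -nneseriesZl; last by move=> k _; rewrite lee_fin.
  rewrite eseries_cond [leRHS]eseries_cond; apply: lee_nneseries => k.
    by move=> _ _; rewrite -EFinM lee_fin !mulr_ge0// ltW.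
  move=> /= Nk; rewrite -EFinM lee_fin mulrC -mulrA ler_wpM2l//.
  by rewrite ler_pM ?large// ltW.
rewrite tail gt0_muley ?lte_fin ?mulr_gt0// => /le_trans; apply.
have cphik0 k : (0 <= k)%N -> (0 <= (c k * phi k * e k.+1)%:E)%E by rewrite lee_fin.
rewrite (nneseries_split 0 N cphik0) add0n leeDr//.
by apply: sume_ge0 => k _; exact: cphik0.
Qed.

Lemma cvg0_of_weighted_sqr s e (eta : R) : (forall k, 0 <= s k) ->
  0 < eta -> (forall k, eta <= e k) -> e k * s k ^+ 2 @[k --> \oo] --> (0 : R) ->
  s k @[k --> \oo] --> (0 : R).
Proof.
move=> s0 eta0 e_eta /cvgrPdist_lt cv; apply/cvgrPdist_lt => r r0.
have er : 0 < eta * r ^+ 2 by rewrite mulr_gt0 ?exprn_gt0.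
apply: filterS (cv _ er) => k; rewrite !sub0r !normrN (ger0_norm (s0 k)).
have e0 : 0 <= e k by rewrite (le_trans (ltW eta0)).
rewrite ger0_norm ?mulr_ge0 ?sqr_ge0// => h.
rewrite -(@ltr_pXn2r _ 2)// ?nnegrE// ?ltW// -(ltr_pM2l eta0).
by apply: le_lt_trans h; rewrite ler_wpM2r// sqr_ge0.
Qed.

End pathwise.

(** * Convergence of the distance to [[0, B]], from the discounted supermartingale *)

Theorem theorem2 (d : measure_display) (T : measurableType d) (R : realType)
  (P : probability T R) (F : nat -> set (set T))
  (z a x y b c : nat -> T -> R) (B : R) :
  filtration F ->
  adapted F z -> adapted F a -> adapted F x -> adapted F y ->
  adapted F b -> adapted F c ->
  (forall n w, 0 <= z n w) -> (forall n w, 0 <= a n w) ->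
  (forall n w, 0 <= x n w) -> (forall n w, 0 <= y n w) ->
  (forall n w, 0 <= b n w) -> (forall n w, 0 <= c n w) ->
  (forall n, exists h : T -> \bar R,
      is_cond_exp P (F n) (z n.+1) h /\
      {ae P, forall w, (h w <= ((1 + a n w) * z n w + x n w - y n w)%:E)%E}) ->
  (* (A1) *)
  {ae P, forall w, (\sum_(0 <= k <oo) (a k w)%:E < +oo)%E} ->
  (* (A2) *)
  (forall n, {ae P, forall w, `|z n.+1 w - z n w| <= b n w * (z n w + 1)}) ->
  {ae P, forall w, (\sum_(0 <= k <oo) ((b k w) ^+ 2)%:E < +oo)%E} ->
  (* (A3) *)
  0 <= B ->
  (forall n w, z n w > B -> x n w - y n w <= - (c n w * (z n w - B))) ->
  {ae P, forall w, (\sum_(0 <= k <oo) (c k w)%:E = +oo)%E} ->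
  {ae P, forall w, (fun n => dist0B B (z n w)) @ \oo --> (0 : R)}.
Proof.
move=> fF Fz Fa Fx Fy Fb Fc z0 a0 x0 y0 b0 c0 cond aoo incr boo B0 drift coo.
pose C : R := 2 * (B + 1) ^+ 2.
have C0 : 0 <= C by rewrite mulr_ge0// sqr_ge0.
pose g k w := a k w + b k w ^+ 2.
have g0 k w : 0 <= g k w by rewrite addr_ge0// sqr_ge0.
(* The sum stops before [n], so [e n.+1] is already [F n]-measurable and can weight a conditional
   expectation given [F n]. *)
pose e n w := expR (- (C * \sum_(k < n) g k w)).
pose s n w := dist0B B (z n w).
pose W n w := e n w * s n w ^+ 2.
pose D n w := 2 * c n w * s n w ^+ 2 * e n.+1 w.
have s0 n w : 0 <= s n w by rewrite /s /dist0B le_max lexx orbT.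
have e0 n w : 0 <= e n w by exact: expR_ge0.
have e1 n w : e n w <= 1.
  by rewrite -expR0 ler_expR oppr_le0 mulr_ge0// sumr_ge0.
(* This is [1 + x <= exp x] at [x = C * g n w]; it is the relation between successive weights that
   [drift_bound] asks for. *)
have eS n w : e n.+1 w * (1 + C * g n w) <= e n w.
  rewrite /e big_ord_recr/= (mulrDr C) opprD expRD -mulrA ler_piMr ?expR_ge0//.
  rewrite expRN mulrC ler_pdivrMr ?expR_gt0// mul1r; exact: expR_ge1Dx.
have e_le n w : e n.+1 w <= e n w.
  by apply: le_trans (eS n w); rewrite ler_peMr// lerDl mulr_ge0.
have Fmono m n : (m <= n)%N -> F m `<=` F n.
  by elim: n => [|n IH]; [rewrite leqn0 => /eqP -> | rewrite leq_eqVlt => /predU1P[->//|/IH mn A /mn /fF.2]].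
have adaptedP (u : nat -> T -> R) n k : adapted F u -> (k <= n)%N ->
    measurable_fun setT (u k : g_sigma_algebraType (F n) -> R).
  by move=> Fu kn; apply/(G_measurableP (fF.1 n)) => S mS; apply: (Fmono k) => //; exact: Fu.
have Fe' n m : (n <= m.+1)%N -> G_measurable (F m) (e n).
  move=> nm; apply/(G_measurableP (fF.1 m)).
  apply: measurableT_comp => //; apply: measurableT_comp => //; apply: measurable_funM => //.
  apply: measurable_sum => k.
  have km : (k <= m)%N by rewrite -ltnS (leq_trans _ nm).
  have ? := adaptedP a m k Fa km; have ? := adaptedP b m k Fb km.
  by rewrite /g; measurability.
have Fe : adapted F e by move=> n; exact: Fe'.
have Fs : adapted F s.
  move=> n; apply/(G_measurableP (fF.1 n)).
  have ? := adaptedP z n n Fz (leqnn n).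
  by rewrite /s /dist0B; measurability.
have FW : adapted F W.
  move=> n; apply/(G_measurableP (fF.1 n)).
  have ? := adaptedP s n n Fs (leqnn n); have ? := adaptedP e n n Fe (leqnn n).
  by rewrite /W; measurability.
have mD n : measurable_fun setT (D n).
  apply: (G_measurable_measurable (fF.1 n)); apply/(G_measurableP (fF.1 n)).
  have ? := adaptedP s n n Fs (leqnn n); have ? := adaptedP c n n Fc (leqnn n).
  have ? := (G_measurableP (fF.1 n) _).1 (Fe' n.+1 n (leqnn _)).
  by rewrite /D; measurability.
have W0 n w : 0 <= W n w by rewrite mulr_ge0// sqr_ge0.
have D0 n w : 0 <= D n w by rewrite !mulr_ge0// sqr_ge0.
(* Here [W + e] is the expanded form of [e (s^2 + 1)]. *)
have step n A : F n A -> (\int[P]_(w in A) (W n.+1 w + e n.+1 w + D n w)%:E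
    <= \int[P]_(w in A) (W n w + e n w)%:E)%E.
  move=> FA; have [h [zh hle]] := cond n.
  have hle' : {ae P, forall w, (h w <= ((1 + a n w) * z n w + (x n w - y n w))%:E)%E}.
    by apply: filterS hle => w; rewrite addrA.
  have := one_step (fF.1 n) (Fz n) (Fb n) (Fc n) (Fe n) (Fe' n.+1 n (leqnn _))
    (G_measurable_measurable (fF.1 n.+1) (Fz n.+1)) zh B0 (z0 n) (z0 n.+1) (a0 n) (c0 n)
    (e0 n) (e0 n.+1) (e1 n.+1) hle' (incr n) (drift n) (eS n) FA.
  under eq_integral do rewrite mulrDr mulr1.
  by under [in leRHS]eq_integral do rewrite mulrDr mulr1.
have FWe : adapted F (fun n w => W n w + e n w).
  move=> n; apply/(G_measurableP (fF.1 n)).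
  have ? := adaptedP W n n FW (leqnn n); have ? := adaptedP e n n Fe (leqnn n).
  by measurability.
have Doo : {ae P, forall w, (\sum_(0 <= k <oo) (D k w)%:E < +oo)%E}.
  apply: (ae_summable_decrements fF FWe mD _ D0 step).
  by move=> n w; rewrite addr_ge0.
have Wcvg : {ae P, forall w, (forall delta, 0 < delta -> forall N : nat,
     exists2 n, (N <= n)%N & W n w <= delta) -> W n w @[n --> \oo] --> (0 : R)}.
  apply: (ae_cvg0_of_frequently_small fF FW Fe W0 e0 e1 e_le) => n A FA.
  apply: le_trans (step n A FA); apply: ge0_le_integral.
  - exact: (sub_sigma_measurable (fF.1 n)).
  - by move=> w _; rewrite lee_fin addr_ge0.
  - apply: measurable_funTS; apply/measurable_EFinP.
    exact: (G_measurable_measurable (fF.1 n.+1) (FWe n.+1)).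
  - apply: measurable_funTS; apply/measurable_EFinP; apply: measurable_funD => //.
    exact: (G_measurable_measurable (fF.1 n.+1) (FWe n.+1)).
  - by move=> w _; rewrite lee_fin lerDl.
(* All the almost sure properties are gathered, and the rest of the argument runs on one fixed
   path. *)
apply: filterS (filterI aoo (filterI boo (filterI coo (filterI Doo Wcvg)))).
move=> w [aw [bw [cw [Dw Ww]]]].
have [eta eta0 eta_le] := discount_lower_bound C0 (fun k => a0 k w) aw bw.
apply: (@cvg0_of_weighted_sqr _ (s ^~ w) (e ^~ w) eta) => //.
apply: Ww.
(* The weights are [2 c], so that the weighted series is exactly that of the [D k]. *)
apply: (@frequently_small _ (fun k => 2 * c k w) (fun k => s k w ^+ 2) (e ^~ w) eta) => //.
- by move=> k; rewrite mulr_ge0.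
- by move=> k; exact: sqr_ge0.
- rewrite (eq_eseriesr (g := fun k => (2%:E * (c k w)%:E)%E))//.
  rewrite nneseriesZl; last by move=> k _; rewrite lee_fin.
  by rewrite cw gt0_muley// lte_fin.
Qed.
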